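(* Let $\{b_{nj}\}_{1\le j\le n,\ n\ge 1}$ be a triangular array of points in $[0,1]$, the points of each stage $n$ being distinct and listed in increasing order $b_{n1}<b_{n2}<\cdots<b_{nn}$. Suppose there exist positive constants $\alpha_1,\alpha_2,B_1,B_2$ with the following properties: (1) $0<\alpha_2\leq\alpha_1<1+\alpha_2$. (2) There exists $n_0\in\mathbb{N}$ such that for every integer $n\geq n_0$, $$B_1\left|\frac{j-k}{n}\right|^{\alpha_1}\leq |b_{nj}-b_{nk}|\leq B_2\left|\frac{j-k}{n}\right|^{\alpha_2}\quad\text{whenever } j,k\in\{1,\ldots,n\}.$$ Then Property $(\star)$ holds for $\{b_{nj}\}$.
   Context: **Property $(\star)$.** Consider a triangular array of real points whose stage $n$ consists of distinct points listed in increasing order $\zeta_{n1}<\zeta_{n2}<\cdots<\zeta_{nn}$. For $j\in\{1,\ldots,n-1\}$ put $$m_{nj}:=\tfrac12(\zeta_{nj}+\zeta_{n(j+1)}),\quad s_n(j):=|m_{nj}-\zeta_{nj}|,\quad H_n(j):=\left(\frac1n\sum_{k=1}^n\frac{1}{|m_{nj}-\zeta_{nk}|}\right)^{-1}.$$ The array has Property $(\star)$ if $$\lim_{n\to\infty}\max\left\{\frac{s_n(j)}{H_n(j)} : j=1,\ldots,n-1\right\}=0.$$ *)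

(* Defs.v *)
From HB Require Import structures.
From mathcomp Require Import all_boot all_order all_algebra.
From mathcomp Require Import all_classical all_reals all_analysis.

Set Implicit Arguments.
Unset Strict Implicit.
Unset Printing Implicit Defensive.

Import Order.TTheory GRing.Theory Num.Theory.
Import numFieldNormedType.Exports.

Local Open Scope classical_set_scope.
Local Open Scope ring_scope.

(* A triangular array is a function [z : nat -> nat -> R]; the entries of
   stage [n] are [z n 1, ..., z n n], and no other value [z n j] is ever used. *)

Definition increasing_array (R : realType) (z : nat -> nat -> R) : Prop :=
  forall n j k : nat, (1 <= j)%N -> (j < k)%N -> (k <= n)%N -> z n j < z n k.

Definition midpoint (R : realType) (z : nat -> nat -> R) (n j : nat) : R :=
  2^-1 * (z n j + z n j.+1).

Definition half_gap (R : realType) (z : nat -> nat -> R) (n j : nat) : R :=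
  `|midpoint z n j - z n j|.

Definition harmonic_mean_dist (R : realType) (z : nat -> nat -> R)
    (n j : nat) : R :=
  (n%:R^-1 * \sum_(1 <= k < n.+1) `|midpoint z n j - z n k|^-1)^-1.

(* The ratios are nonnegative, so starting the maximum at 0 does not change it
   for [n >= 2]; for [n <= 1] there is no index [j] and the value is 0. *)
Definition property_star (R : realType) (z : nat -> nat -> R) : Prop :=
  (fun n : nat => \big[Num.max/0]_(1 <= j < n)
                    (half_gap z n j / harmonic_mean_dist z n j)) @ \oo
    --> (0 : R).

(* Main.v *)
Require Import Defs.
From HB Require Import structures.
From mathcomp Require Import all_boot all_order all_algebra.
From mathcomp Require Import all_classical all_reals all_analysis.
From mathcomp Require Import zify ring lra.

Set Implicit Arguments.
Unset Strict Implicit.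
Unset Printing Implicit Defensive.

Import Order.TTheory GRing.Theory Num.Theory.
Import numFieldNormedType.Exports.

Local Open Scope classical_set_scope.
Local Open Scope ring_scope.

(** Write [h n] for the partial harmonic sum [1 + 1/2 + ... + 1/n].  The
    two-sided bound enters through consecutive points: a gap of stage [n] lies
    between [B1 * n^-alpha1] and [B2 * n^-alpha2].

    Fix a stage [n] and an index [j], let [m] be the midpoint of the [j]-th gap
    and [s] half its length.  In the ratio, that is in the sum of the
    [s / (n * |m - b n k|)], the two endpoints [k = j, j+1] contribute [1 / n]
    each.  On either side, the points farther away are spaced at least
    [C = B1 * n^-alpha1] apart, so the [i]-th one is at distance at least [i * C]
    from [m], and the reciprocal distances add up to at most [h n / C].  Hence
    ([half_gap_ratio_le]) the ratio is at most [(2 + 2 * s / C * h n) / n], and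
    [s <= B2 * n^-alpha2 / 2] turns this into
      [2 / n + (B2 / B1) * n^-c * h n]  with  [c = 1 + alpha2 - alpha1].
    The hypothesis [alpha1 < 1 + alpha2] says that [c > 0], and [h n] grows only
    logarithmically, so [n^-c * h n] tends to 0 ([powRN_mul_harmonic_le]).  The
    bound does not depend on [j], so it applies to the maximum. *)

Lemma series_harmonic_ge0 (R : realType) n : 0 <= series (@harmonic R) n.
Proof. by apply: sumr_ge0 => i _; exact: harmonic_ge0. Qed.

Lemma series_harmonic_le (R : realType) m n : (m <= n)%N ->
  series (@harmonic R) m <= series (@harmonic R) n.
Proof.
elim: n => [|n IH]; first by rewrite leqn0 => /eqP ->.
rewrite leq_eqVlt => /predU1P[->//|]; rewrite ltnS => /IH mn.
by rewrite seriesSr (le_trans mn)// lerDl harmonic_ge0.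
Qed.

Lemma series_harmonic_le_ln (R : realType) n :
  series (@harmonic R) n.+1 <= 1 + ln n.+1%:R.
Proof.
elim: n => [|n IH].
  by rewrite /series/= big_nat1 /harmonic/= invr1 ln1 addr0.
rewrite seriesSr /harmonic/=.
(* [1/(n+2) <= ln (n+2) - ln (n+1)], from [ln (1 - x) <= -x] at
   [x = 1/(n+2)]. *)
suff : ln (n.+1%:R / n.+2%:R : R) <= - n.+2%:R^-1.
  rewrite ln_div ?posrE// => lnB.
  apply: (le_trans (lerD IH (lexx _))).
  by rewrite -addrA lerD2l -lerBrDl -lerN2 opprB.
have -> : (n.+1%:R / n.+2%:R : R) = 1 + - n.+2%:R^-1.
  have n2 : n.+2%:R != 0 :> R by rewrite pnatr_eq0.
  apply: (mulIf n2); rewrite divfK// mulrDl mul1r mulNr mulVf//.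
  by rewrite -[n.+2%:R]natr1 addrK.
by apply: le_ln1Dx; rewrite ltrN2 invf_lt1// ltr1n.
Qed.

(** Half of the power [n^-c] absorbs the logarithm, since [ln x = ln (x^e) / e]
    is at most [x^e / e] for every [e > 0]. *)
Lemma powRN_mul_harmonic_le (R : realType) (c : R) n : 0 < c -> (0 < n)%N ->
  n%:R `^ (- c) * series (@harmonic R) n
    <= (1 + 2 / c) * n%:R `^ (- (c / 2)).
Proof.
case: n => // n c0 _; set x : R := n.+1%:R.
have x1 : 1 <= x by rewrite ler1n.
have x0 : 0 < x by exact: lt_le_trans x1.
have c20 : 0 < c / 2 by rewrite divr_gt0.
have lnx : ln x <= 2 / c * x `^ (c / 2).
  have := ltW (ln_sublinear (powR_gt0 (c / 2) x0)).
  by rewrite ln_powR mulrC -ler_pdivlMr// invf_div mulrC.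
have p1 : 1 <= x `^ (c / 2).
  by rewrite -[leLHS](powRr0 x); apply: ler_powR => //; exact: ltW.
have -> : - c = - (c / 2) + - (c / 2) by field.
rewrite powRD ?(gt_eqF x0) ?implybT// -mulrA mulrC.
rewrite ler_wpM2r ?powR_ge0// powRN.
rewrite -[leRHS](mulKf (lt0r_neq0 (powR_gt0 (c / 2) x0))).
rewrite ler_wpM2l ?invr_ge0 ?powR_ge0//.
apply: (le_trans (series_harmonic_le_ln R n)).
by rewrite mulrDr mulr1 (mulrC _ (2 / c)) lerD.
Qed.

Lemma cvg_natr_powRN (R : realType) (d : R) : 0 < d ->
  (n%:R : R) `^ (- d) @[n --> \oo] --> 0.
Proof.
move=> d0; rewrite -cvg_shiftS/=.
have -> : (fun n => n.+1%:R `^ (- d)) = (fun n => (harmonic n : R) `^ d).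
  apply/funext => n; rewrite /harmonic/= -powR_inv1 ?ler0n//.
  by rewrite -powRrM mulN1r.
have /cvg_at_rightP := @powR_cvg0 R d d0.
by apply; split; [exact: harmonic_gt0|exact: cvg_harmonic].
Qed.

Lemma mulr_gap_le (R : realDomainType) (x : nat -> R) (C : R) n :
  (forall k, (0 < k < n)%N -> C <= x k.+1 - x k) ->
  forall i d, (0 < i)%N -> (i + d <= n)%N -> C * d%:R <= x (i + d)%N - x i.
Proof.
move=> gap i; elim=> [|d IH] i0 idn; first by rewrite mulr0 addn0 subrr.
have := gap (i + d)%N; rewrite addnS in idn *.
have := IH i0 (ltnW idn).
move=> IH' /(_ _)/[!idn]; rewrite addn_gt0 i0 => /(_ isT) g.
rewrite -natr1 mulrDr mulr1; lra.
Qed.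

(** A minimal spacing [C] of the points bounds the sum of reciprocal distances
    to a midpoint by a harmonic sum on each side; the endpoints of the gap are
    kept apart, because only there does the half gap cancel exactly. *)
Lemma half_gap_ratio_le (R : realType) (z : nat -> nat -> R) (C : R) n j :
  0 < C -> (forall k, (0 < k < n)%N -> C <= z n k.+1 - z n k) ->
  (0 < j < n)%N ->
  half_gap z n j / harmonic_mean_dist z n j
    <= (2 + 2 * half_gap z n j / C * series (@harmonic R) n) / n%:R.
Proof.
move=> C0 gap /andP[j0 jn].
have spaced := mulr_gap_le gap.
have gj : C <= z n j.+1 - z n j by apply: gap; rewrite j0.
have hgE : half_gap z n j = (z n j.+1 - z n j) / 2.
  rewrite /half_gap /midpoint.
  rewrite (_ : 2^-1 * _ - _ = (z n j.+1 - z n j) / 2); last by field.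
  by rewrite ger0_norm//; lra.
set s := half_gap z n j in hgE *.
have s0 : 0 < s by lra.
have mE : midpoint z n j = z n j + s by rewrite /midpoint hgE; field.
have mE' : midpoint z n j = z n j.+1 - s by rewrite /midpoint hgE; field.
rewrite /harmonic_mean_dist invrK mulrCA [leRHS]mulrC.
rewrite ler_wpM2l ?invr_ge0 ?ler0n//.
pose F k := `|midpoint z n j - z n k|^-1.
rewrite -[X in s * X]/(\sum_(1 <= k < n.+1) F k).
have far i k : C * i.+1%:R <= `|midpoint z n j - z n k| ->
    F k <= C^-1 * harmonic i.
  by move=> h; rewrite /F /harmonic/= -invfM lef_pV2 ?posrE// ?(lt_le_trans _ h)
    ?mulr_gt0.
have left : \sum_(1 <= k < j) F k <= C^-1 * series (@harmonic R) n.
  apply: (@le_trans _ _ (C^-1 * series (@harmonic R) j.-1)); last first.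
    by rewrite ler_wpM2l ?invr_ge0 ?(ltW C0)// series_harmonic_le//; lia.
  rewrite -{1}(prednK j0) big_add1 /= big_nat_rev/= /series/= mulr_sumr.
  rewrite big_nat [leRHS]big_nat; apply: ler_sum => i /andP[_ ij].
  apply: far; have := spaced (0 + j.-1 - i.+1).+1 i.+1 isT.
  rewrite (_ : ((0 + j.-1 - i.+1).+1 + i.+1 = j)%N); last by lia.
  move=> /(_ (ltnW jn)) h.
  have Ci : 0 <= C * i.+1%:R by rewrite mulr_ge0 ?ler0n// ltW.
  by rewrite mE ger0_norm; lra.
have right : \sum_(j.+2 <= k < n.+1) F k <= C^-1 * series (@harmonic R) n.
  apply: (@le_trans _ _ (C^-1 * series (@harmonic R) (n - j.+1)%N)); last first.
    by rewrite ler_wpM2l ?invr_ge0 ?(ltW C0)// series_harmonic_le//; lia.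
  rewrite -{1}[j.+2]add0n big_addn subSS /series/= mulr_sumr.
  rewrite big_nat [leRHS]big_nat; apply: ler_sum => i /andP[_ ij].
  apply: far; have := spaced j.+1 i.+1 isT.
  rewrite (_ : (j.+1 + i.+1 = i + j.+2)%N); last by lia.
  move=> /(_ ltac:(lia)) h.
  have Ci : 0 <= C * i.+1%:R by rewrite mulr_ge0 ?ler0n// ltW.
  by rewrite mE' ler0_norm; lra.
rewrite (@big_cat_nat _ _ _ j)//; last by lia.
rewrite (@big_ltn _ _ _ j)//; last by lia.
rewrite (@big_ltn _ _ _ j.+1)//.
have -> : F j = s^-1 by rewrite /F mE addrAC subrr add0r gtr0_norm.
have -> : F j.+1 = s^-1.
  by rewrite /F mE' addrAC subrr add0r normrN gtr0_norm.
move: left right; set L := \sum_(1 <= k < j) _; set T := \sum_(_ <= k < _) _.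
set h := series _ _ => left right /=; clearbody s L T h.
have -> : 2 + 2 * s / C * h = s * (C^-1 * h + (s^-1 + (s^-1 + C^-1 * h))).
  have [sN0 CN0] : s != 0 /\ C != 0 by rewrite !gt_eqF.
  by field; rewrite sN0 CN0.
by rewrite ler_wpM2l ?(ltW s0)// !(lerD, lexx).
Qed.

Theorem theorem3p2 (R : realType) (b : nat -> nat -> R)
    (b01 : forall n j : nat, (1 <= j <= n)%N -> 0 <= b n j <= 1)
    (b_incr : increasing_array b)
    (alpha1 alpha2 B1 B2 : R)
    (alpha1_gt0 : 0 < alpha1) (alpha2_gt0 : 0 < alpha2)
    (B1_gt0 : 0 < B1) (B2_gt0 : 0 < B2)
    (alpha21 : alpha2 <= alpha1) (alpha12 : alpha1 < 1 + alpha2)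
    (holder : exists n0 : nat, forall n : nat, (n0 <= n)%N ->
       forall j k : nat, (1 <= j <= n)%N -> (1 <= k <= n)%N ->
         B1 * `|(j%:R - k%:R) / n%:R| `^ alpha1 <= `|b n j - b n k| /\
         `|b n j - b n k| <= B2 * `|(j%:R - k%:R) / n%:R| `^ alpha2) :
  property_star b.
Proof.
have [n0 hol] := holder.
pose c := 1 + alpha2 - alpha1.
have c0 : 0 < c by rewrite /c; lra.
pose K := 2 + B2 / B1 * (1 + 2 / c).
have c20 : 0 < c / 2 by rewrite divr_gt0.
have K0 : 0 <= K.
  by rewrite /K addr_ge0// mulr_ge0// ?addr_ge0// divr_ge0// ltW.
have cvgK : K * (n%:R `^ (- (c / 2))) @[n --> \oo] --> (0 : R).
  by rewrite -[X in _ --> X](mulr0 K); apply: cvgMr; exact: cvg_natr_powRN.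
apply: (squeeze_cvgr _ (cvg_cst 0) cvgK).
near=> n.
have n0n : (n0 <= n)%N by near: n; exact: nbhs_infty_ge.
have npos : (0 < n)%N by near: n; exact: nbhs_infty_gt.
rewrite bigmax_ge_id/= big_nat; apply: bigmax_le.
  by rewrite mulr_ge0// powR_ge0.
move=> j jn.
set x : R := n%:R.
have x0 : 0 < x by rewrite ltr0n.
have x1 : 1 <= x by rewrite ler1n.
have gap k : (0 < k < n)%N ->
    B1 * x `^ (- alpha1) <= b n k.+1 - b n k <= B2 * x `^ (- alpha2).
  move=> /andP[k0 kn]; have [] := hol n n0n k.+1 k; rewrite ?k0 ?(ltnW kn)//.
  rewrite -natrB// subSnn mul1r ger0_norm ?invr_ge0 ?ler0n//.
  rewrite -powR_inv1 ?ler0n// -!powRrM !mulN1r gtr0_norm; first by move=> -> ->.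
  by rewrite subr_gt0 b_incr.
have C0 : 0 < B1 * x `^ (- alpha1) by rewrite mulr_gt0// powR_gt0.
have /le_trans := half_gap_ratio_le C0 (fun k kn => proj1 (andP (gap k kn))) jn.
apply.
have sE : 2 * half_gap b n j <= B2 * x `^ (- alpha2).
  have /andP[_ g] := gap j jn.
  apply: le_trans g; rewrite /half_gap /midpoint.
  rewrite (_ : 2^-1 * _ - _ = (b n j.+1 - b n j) / 2); last by field.
  have : 0 < b n j.+1 - b n j by case/andP: jn => j0 jn; rewrite subr_gt0 b_incr.
  by move=> g0; rewrite ger0_norm; lra.
set h := series _ _.
apply: (@le_trans _ _ (2 * x^-1 + B2 / B1 * (x `^ (- c) * h))).
  have -> : x `^ (- c) = x `^ (- alpha2) / x `^ (- alpha1) / x.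
    rewrite -[X in _ / X](powRr1 (ltW x0)) -!powRB ?(gt_eqF x0) ?implybT//.
    by congr (_ `^ _); rewrite /c; ring.
  rewrite mulrDl lerD2l.
  have -> : B2 / B1 * (x `^ (- alpha2) / x `^ (- alpha1) / x * h)
      = B2 * x `^ (- alpha2) / (B1 * x `^ (- alpha1)) * h / x.
    by field; rewrite !gt_eqF ?powR_gt0.
  rewrite ler_wpM2r ?invr_ge0 ?(ltW x0)// ler_wpM2r ?series_harmonic_ge0//.
  by rewrite ler_wpM2r// invr_ge0 ltW.
rewrite /K [leRHS]mulrDl -[X in _ <= _ + X]mulrA; apply: lerD.
  (* [alpha2 <= alpha1] gives [c <= 1], so [n^-1] decays at least as fast. *)
  rewrite ler_wpM2l// -powR_inv1 ?ler0n//; apply: ler_powR => //.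
  rewrite /c; lra.
rewrite ler_wpM2l ?divr_ge0 ?(ltW B1_gt0) ?(ltW B2_gt0)//.
exact: powRN_mul_harmonic_le.
Unshelve. all: by end_near.
Qed.
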